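(* Let $\Omega$ be a metric space with Borel $\sigma$-algebra $\mathcal F$, and let $\mathcal P,\mathcal Q\subset\mathcal M_1$ be nonempty sets that are convex and compact in the usual topology of weak convergence of probability measures. Then $$R(\mathcal P,\mathcal Q)=\inf_{\phi\in\Phi\cap C_b}R(\phi,\mathcal P,\mathcal Q)=1-\mathrm d_{\mathrm{TV}}(\mathcal P,\mathcal Q)=1-\mathrm d_{\mathrm{TV}}\big(\overline{\mathrm{co}}^*(\mathcal P),\overline{\mathrm{co}}^*(\mathcal Q)\big).$$ In particular, for every $\varepsilon\ge0$, $$\exists\,\phi\in\Phi:\ \inf_{\nu\in\mathcal Q}\mathbb E_\nu[\phi]>\sup_{\mu\in\mathcal P}\mathbb E_\mu[\phi]+\varepsilon\quad\Longleftrightarrow\quad\mathrm d_{\mathrm{TV}}\big(\overline{\mathrm{co}}(\mathcal P),\overline{\mathrm{co}}(\mathcal Q)\big)>\varepsilon,$$ and when these conditions hold the test $\phi$ can be taken to be continuous. Moreover, the infimum defining $\mathrm d_{\mathrm{TV}}(\mathcal P,\mathcal Q)$ is achieved by some $\mu\in\mathcal P$, $\nu\in\mathcal Q$.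
   Context: $\mathcal M_1$ is the set of all countably additive probability measures on $(\Omega,\mathcal F)$; $C_b$ is the set of bounded continuous real functions on $\Omega$. The topology of weak convergence on $\mathcal M_1$ is the weakest topology for which $\mu\mapsto\mathbb E_\mu[f]$ is continuous for every $f\in C_b$. A test is an $\mathcal F$-measurable function $\phi:\Omega\to[0,1]$; $\Phi$ is the set of all tests. The risk of a test is $R(\phi,\mathcal P,\mathcal Q)=\sup_{\mu\in\mathcal P}\mathbb E_\mu[\phi]+\sup_{\nu\in\mathcal Q}\mathbb E_\nu[1-\phi]$ and the minimax risk is $R(\mathcal P,\mathcal Q)=\inf_{\phi\in\Phi}R(\phi,\mathcal P,\mathcal Q)$. $\mathcal L$ is the Banach space of bounded measurable real functions on $\Omega$ with the supremum norm. $\mathsf{ba}$ is the space of bounded finitely additive real-valued set functions on $\mathcal F$, with norm $\|\mu\|_{\mathrm{TV}}=\sup_\pi\sum_{A\in\pi}|\mu(A)|$ (supremum over finite measurable partitions $\pi$ of $\Omega$); it is the dual of $\mathcal L$ via $\mathbb E_\mu[f]=\int f\,d\mu$ (integral of simple functions extended by uniform limits). $\mathsf{ba}_1$ is the set of nonnegative elements of $\mathsf{ba}$ with $\mu(\Omega)=1$; $\mathcal M_1\subset\mathsf{ba}_1$. The weak-$*$ topology on $\mathsf{ba}$ is the weakest topology making $\mu\mapsto\mathbb E_\mu[f]$ continuous for all $f\in\mathcal L$. $\mathrm{co}(\mathcal P)$ is the convex hull, $\overline{\mathrm{co}}(\mathcal P)$ is its closure in total-variation norm, and $\overline{\mathrm{co}}^*(\mathcal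 P)$ is its weak-$*$ closure in $\mathsf{ba}$. For $\mu,\nu\in\mathsf{ba}_1$, $\mathrm d_{\mathrm{TV}}(\mu,\nu)=\tfrac12\|\mu-\nu\|_{\mathrm{TV}}=\sup_{\phi\in\Phi}(\mathbb E_\mu[\phi]-\mathbb E_\nu[\phi])$; for nonempty $S,T\subset\mathsf{ba}_1$, $\mathrm d_{\mathrm{TV}}(S,T)=\inf_{\mu\in S,\nu\in T}\mathrm d_{\mathrm{TV}}(\mu,\nu)$. *)

(* Defs.v *)
From HB Require Import structures.
From mathcomp Require Import all_boot all_order all_algebra.
From mathcomp Require Import all_classical all_reals all_analysis.

Set Implicit Arguments.
Unset Strict Implicit.
Unset Printing Implicit Defensive.

Import Order.TTheory GRing.Theory Num.Theory.
Import numFieldNormedType.Exports.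

Local Open Scope classical_set_scope.
Local Open Scope ring_scope.

(* [measurableType] requires a point, which [metricType] does not provide. *)
#[short(type="pmetricType")]
HB.structure Definition PointedMetric (R : numDomainType) :=
  {T of Metric R T & Pointed T}.

Notation borel T := (g_sigma_algebraType (@open T)).

Section ba.
Context d (T : measurableType d) (R : realType).
Implicit Types A B : set T.

(* A set function on the sigma-algebra is represented by its extension by [0]
   to all of [set T], so that equality in [ba] is equality on measurable sets. *)
Definition is_ba (mu : set T -> R^o) : Prop :=
  [/\ forall A, ~ measurable A -> mu A = 0,
      forall A B, measurable A -> measurable B -> A `&` B = set0 ->
        mu (A `|` B) = mu A + mu B
    & exists M : R, forall A, measurable A -> `|mu A| <= M].

Definition ba_pred : {pred set T -> R^o} := fun mu => `[< is_ba mu >].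

Lemma ba_submod_closed : submod_closed ba_pred.
Proof.
split=> [|a u v /asboolP[u0 uD [M uM]] /asboolP[v0 vD [N vN]]]; apply/asboolP.
  split=> //=; first by move=> A B _ _ _; rewrite addr0.
  by exists 0 => A _; rewrite normr0.
have E A : (a *: u + v) A = a * u A + v A by [].
split=> [A nA|A B mA mB AB|].
- by rewrite E u0// v0// addr0 mulr0.
- by rewrite !E uD// vD// mulrDr addrACA.
- exists (`|a| * M + N) => A mA; rewrite E.
  by rewrite (le_trans (ler_normD _ _))// lerD ?vN// normrM ler_wpM2l// uM.
Qed.

HB.instance Definition _ :=
  GRing.isSubmodClosed.Build R (set T -> R^o) ba_pred ba_submod_closed.

Record ba : Type := Ba { ba_val :> set T -> R^o ; baP : ba_val \in ba_pred }.

HB.instance Definition _ := [isSub for ba_val].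
HB.instance Definition _ := [Choice of ba by <:].
HB.instance Definition _ := [SubChoice_isSubLmodule of ba by <:].

Lemma ba_prop (mu : ba) : is_ba mu.
Proof. by case: mu => mu /= /asboolP. Qed.

(* Empty blocks are harmless, since they do not contribute to the sums in
   [tv_norm]. *)
Definition finite_mpartition n (F : 'I_n -> set T) : Prop :=
  [/\ forall i, measurable (F i), trivIset setT F & \bigcup_i F i = setT].

Definition tv_sums (mu : ba) : set R :=
  [set x | exists n (F : 'I_n -> set T),
    finite_mpartition F /\ x = \sum_(i < n) `|mu (F i)|].

Definition tv_norm (mu : ba) : R := sup (tv_sums mu).

Lemma ba_set0 (mu : ba) : mu set0 = 0.
Proof.
have [_ D _] := ba_prop mu.
have := D _ _ measurable0 measurable0 (setI0 set0).
by rewrite setU0 -[X in X = _]addr0 => /addrI <-.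
Qed.

Lemma ba_bigsetU (mu : ba) n (F : 'I_n -> set T) (P : pred 'I_n) :
  (forall i, measurable (F i)) -> trivIset setT F ->
  mu (\big[setU/set0]_(i < n | P i) F i) = \sum_(i < n | P i) mu (F i).
Proof.
have [_ D _] := ba_prop mu.
move=> mF tF.
have H (s : seq 'I_n) : uniq s ->
    mu (\big[setU/set0]_(i <- s) F i) = \sum_(i <- s) mu (F i).
  elim: s => [_|i s ih /= /andP[si us]]; first by rewrite !big_nil ba_set0.
  rewrite !big_cons.
  have mS : measurable (\big[setU/set0]_(j <- s) F j).
    exact: bigsetU_measurable.
  rewrite (D _ _ (mF i) mS) ?(ih us)//.
  rewrite big_distrr/= big_seq big1// => j js.
  move/trivIsetP : tF; apply => //.
  by apply: contraNneq si => ->.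
have := H _ (filter_uniq P (index_enum_uniq 'I_n)).
by rewrite !big_filter.
Qed.

Lemma tv_sums_ubound (mu : ba) : has_ubound (tv_sums mu).
Proof.
have [_ _ [M bM]] := ba_prop mu.
exists (M + M) => _ [n [F [[mF tF _] ->]]].
rewrite (bigID (fun i => 0 <= mu (F i)))/= lerD//.
  rewrite (eq_bigr (mu \o F))/=; last by move=> i /ger0_norm.
  by rewrite -ba_bigsetU// (le_trans (ler_norm _))// bM//; exact: bigsetU_measurable.
rewrite (eq_bigr (fun i => - mu (F i)))/=; last first.
  by move=> i; rewrite -ltNge => /ltr0_norm.
rewrite sumrN -ba_bigsetU// (le_trans (ler_norm _))// normrN bM//.
exact: bigsetU_measurable.
Qed.

Lemma finite_mpartition1 : finite_mpartition (fun _ : 'I_1 => [set: T]).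
Proof.
split=> //; first by move=> i j _ _ _; rewrite !ord1.
by apply/seteqP; split=> // x _; exists ord0.
Qed.

Lemma tv_sums_neq0 (mu : ba) : tv_sums mu !=set0.
Proof.
exists (\sum_(i < 1) `|mu setT|), 1, (fun=> setT).
by split=> //; exact: finite_mpartition1.
Qed.

Lemma tv_sums_sup (mu : ba) : has_sup (tv_sums mu).
Proof. by split; [exact: tv_sums_neq0|exact: tv_sums_ubound]. Qed.

Lemma tv_sum_le (mu : ba) n (F : 'I_n -> set T) :
  finite_mpartition F -> \sum_(i < n) `|mu (F i)| <= tv_norm mu.
Proof. by move=> pF; apply: (ub_le_sup (tv_sums_ubound mu)); exists n, F. Qed.

Lemma tv_norm_le (mu : ba) (x : R) :
  (forall n (F : 'I_n -> set T), finite_mpartition F ->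
    \sum_(i < n) `|mu (F i)| <= x) -> tv_norm mu <= x.
Proof.
by move=> h; apply: ge_sup; [exact: tv_sums_neq0|move=> _ [n [F [pF ->]]]; exact: h].
Qed.

Lemma tv_normD (mu nu : ba) : tv_norm (mu + nu) <= tv_norm mu + tv_norm nu.
Proof.
apply: tv_norm_le => n F pF.
rewrite (le_trans _ (lerD (tv_sum_le mu pF) (tv_sum_le nu pF)))//.
by rewrite -big_split/=; apply: ler_sum => i _; exact: ler_normD.
Qed.

Lemma tv_normZ_le (a : R) (mu : ba) : tv_norm (a *: mu) <= `|a| * tv_norm mu.
Proof.
apply: tv_norm_le => n F pF.
rewrite (le_trans _ (ler_wpM2l (normr_ge0 a) (tv_sum_le mu pF)))//.
by rewrite mulr_sumr; apply: ler_sum => i _; rewrite -normrM.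
Qed.

Lemma tv_normZ (a : R) (mu : ba) : tv_norm (a *: mu) = `|a| * tv_norm mu.
Proof.
apply/eqP; rewrite eq_le tv_normZ_le/=.
have [->|a0] := eqVneq a 0.
  rewrite normr0 mul0r; apply: le_trans (tv_sum_le _ finite_mpartition1).
  exact: sumr_ge0.
rewrite -ler_pdivlMl ?normr_gt0// -normfV.
by rewrite -[X in tv_norm X <= _](scalerK a0) tv_normZ_le.
Qed.

Lemma tv_norm_eq0 (mu : ba) : tv_norm mu = 0 -> mu = 0.
Proof.
have [mu0 _ _] := ba_prop mu.
move=> n0; apply/val_inj/funext => A /=.
have [mA|/mu0 //] := pselect (measurable A).
pose F (i : 'I_2) := if i == ord0 then A else ~` A.
have pF : finite_mpartition F.
  split.
  - by move=> i; rewrite /F; case: ifP => // _; exact: measurableC.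
  - apply/trivIsetP => i j _ _; rewrite /F.
    case: i j => [[|[|//]]] i [[|[|//]]] j //= _; first exact: setICr.
    exact: setICl.
  - apply/seteqP; split=> // x _.
    have [Ax|nAx] := pselect (A x); first by exists ord0.
    by exists (Ordinal (ltnSn 1)).
have := tv_sum_le mu pF.
rewrite n0 big_ord_recl /F eqxx => h; apply/eqP; rewrite -normr_le0.
by apply: le_trans h; rewrite lerDl; exact: sumr_ge0.
Qed.

HB.instance Definition _ :=
  Lmodule_isNormed.Build R ba tv_normD tv_normZ tv_norm_eq0.

Definition bounded_measurable : set (T -> R) :=
  [set f : T -> R | measurable_fun setT f /\ bounded_fun f].

Definition simple : set (T -> R) :=
  [set s : T -> R | measurable_fun setT s /\ finite_set (range s)].

Definition ba_sint (mu : ba) (s : T -> R) : R :=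
  \sum_(r \in range s) r * mu (s @^-1` [set r]).

(* The limit of [ba_sint mu s] as the simple function [s] converges uniformly
   to [f]. *)
Definition ba_int (mu : ba) (f : T -> R) : R :=
  lim (ba_sint mu @ within simple (nbhs (f : {uniform T -> R}))).

Definition weak_star : Type :=
  sup_topology (fun f : set_type bounded_measurable =>
    Topological.class (initial_topology (fun mu : ba => ba_int mu (val f)))).

HB.instance Definition _ := Topological.on weak_star.

Definition probability_fun (P : probability T R) : set T -> R^o :=
  fun A => if `[< measurable A >] then fine (P A) else 0.

Lemma ba_of_probability_subproof (P : probability T R) : probability_fun P \in ba_pred.
Proof.
apply/asboolP; rewrite /probability_fun; split=> [A /asboolPn/negbTE -> //|A B mA mB AB|].
  rewrite !asboolT//; last exact: measurableU.
  by rewrite measureU// fineD// fin_num_measure.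
exists 1 => A mA; rewrite asboolT// ger0_norm ?fine_ge0//.
by rewrite -lee_fin fineK ?fin_num_measure// probability_le1.
Qed.

Definition ba_of_probability (P : probability T R) : ba :=
  Ba (ba_of_probability_subproof P).

(* Passing to the image identifies elements of [probability T R] that only
   differ on non-measurable sets. *)
Definition in_ba (P : set (probability T R)) : set ba := ba_of_probability @` P.

Definition tests : set (T -> R) :=
  [set phi : T -> R | measurable_fun setT phi /\ forall x, 0 <= phi x <= 1].

Definition test_risk (P Q : set (probability T R)) (phi : T -> R) : R :=
  sup [set \int[mu]_x phi x | mu in P] +
  sup [set \int[nu]_x (1 - phi x) | nu in Q].

Definition minimax_risk (P Q : set (probability T R)) : R :=
  inf [set test_risk P Q phi | phi in tests].

Definition tv_dist (mu nu : ba) : R := 2^-1 * `|mu - nu|.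

Definition tv_dist_set (S S' : set ba) : R :=
  inf [set tv_dist mu nu | mu in S & nu in S'].

Definition convex_hull (S : set ba) : set ba := smallest (@convex_set R ba) S.

Definition tv_closed_hull (S : set ba) : set ba := closure (convex_hull S).

Definition weak_star_closed_hull (S : set ba) : set ba :=
  closure (convex_hull S : set weak_star).

End ba.
Arguments ba {d} T R.
Arguments tests {d} T R.

Section weak_convergence.
Context (R : realType) (T : pmetricType R).

Definition bounded_continuous : set (T -> R) :=
  [set f : T -> R | continuous f /\ bounded_fun f].

Definition weak_convergence : Type :=
  sup_topology (fun f : set_type bounded_continuous =>
    Topological.class (initial_topology
      (fun mu : probability (borel T) R => \int[mu]_x (val f x)))).

HB.instance Definition _ := Topological.on weak_convergence.

End weak_convergence.
Arguments bounded_continuous {R} T.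
Arguments weak_convergence {R} T.

(* Main.v *)
Require Import Defs.
From HB Require Import structures.
From mathcomp Require Import all_boot all_order all_algebra.
From mathcomp Require Import all_classical all_reals all_analysis.
From mathcomp Require Import measurable_realfun finmap lra.

Set Implicit Arguments.
Unset Strict Implicit.
Unset Printing Implicit Defensive.

Import Order.TTheory GRing.Theory Num.Theory.
Import numFieldNormedType.Exports.

Local Open Scope classical_set_scope.
Local Open Scope ring_scope.

(* A finite-dimensional minimax argument and compactness of [P * Q] for weak
   convergence give a pair [(mu, nu)] in [P * Q] such that no continuous test
   separates [mu] from [nu] better than the best continuous test separates [P]
   from [Q]. On a metric space indicators of Borel sets are L^1-limits of
   continuous tests, hence [mu] and [nu] realize the total variation distance,
   which is also the supremum of the gaps of continuous tests. A test is
   uniformly approximated by step functions, so its gap is controlled by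
   finitely many evaluations [m |-> m A]; these are continuous for both the
   total variation and the weak-* topologies, and therefore taking closures
   does not decrease the distance. *)

(** * A minimax inequality on compact sets *)

Section minimax.
Context {R : realType} {X : topologicalType} {I : choiceType}.
Variables (K : set X) (D : set I) (g : I -> X -> R).
Hypotheses (K0 : K !=set0) (compactK : compact K).
Hypothesis g_continuous : forall i, D i -> continuous (g i).
(** Both convexity hypotheses are phrased through the values of [g], since [I] and [X] carry no
    linear structure; sets of probability measures are thus covered directly. *)
Hypothesis D_convex : forall (s : seq I) (w : I -> R),
  (forall i, i \in s -> D i) -> (forall i, 0 <= w i) ->
  \sum_(i <- s) w i = 1 ->
  exists2 j, D j & forall x, K x -> g j x = \sum_(i <- s) w i * g i x.
Hypothesis K_convex : forall x y (t : R), K x -> K y -> 0 <= t <= 1 ->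
  exists2 z, K z & forall i, D i -> g i z = (1 - t) * g i x + t * g i y.

(** For small [t] the linear term dominates: if [a < 0], the chosen [t] satisfies [t * b < - a], so
    that [2 * a + t * b] is negative. *)
Let ge0_of_quadratic (a b : R) : 0 <= b ->
  (forall t, 0 < t <= 1 -> 0 <= 2 * t * a + t ^+ 2 * b) -> 0 <= a.
Proof.
move=> b0 h; rewrite leNgt; apply/negP => a0.
pose t := Num.min 1 (- a / (b + 1)).
have t0 : 0 < t by rewrite lt_min ltr01/= divr_gt0//; lra.
have t1 : t <= 1 by rewrite ge_min lexx.
have tb : t * (b + 1) <= - a by rewrite -ler_pdivlMr ?ge_min ?lexx ?orbT//; lra.
have := h t; rewrite t0 t1 => /(_ isT).
by rewrite -mulrA (mulrCA 2) expr2 -mulrA -mulrDr pmulr_rge0//; lra.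
Qed.

(* The minimizer [x] over [K] of the sum of the [(g i x - c)_+ ^ 2] yields the
   separating weights [(g i x - c)_+]: the first-order condition at [x] says
   that their combination of the [g i - c] is at least its value at [x]. *)
Lemma finite_minimax (c : R) (s : seq I) : (forall i, i \in s -> D i) ->
  (forall i, D i -> exists2 x, K x & g i x <= c) ->
  exists2 x, K x & forall i, i \in s -> g i x <= c.
Proof.
move=> sD gc.
pose p i x : R := Num.max 0 (g i x - c).
have p_cont i : D i -> continuous (p i).
  move=> Di x; apply: (@continuous_max _ _ (cst 0) (fun y => g i y - c)).
    exact: cvg_cst.
  by apply: cvgB; [exact: g_continuous|exact: cvg_cst].
pose F x := \sum_(i <- s) p i x ^+ 2.
have F_cont : continuous F.
  have -> : F = fun x => \sum_(i <- s | i \in s) p i x ^+ 2.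
    by apply/funext => x; rewrite /F big_seq.
  move=> x; apply: cvg_big => [|i /sD Di]; first exact: add_continuous.
  under eq_fun do rewrite expr2.
  by rewrite expr2; apply: cvgM; exact: p_cont.
have [x /set_mem Kx Fmin] :
    exists2 x, x \in K & forall y, y \in K -> F x <= F y.
  by apply: compact_EVT_min => //; exact: continuous_subspaceT.
exists x => // i0 i0s; rewrite leNgt; apply/negP => gi0.
have p0 i y : 0 <= p i y by rewrite le_max lexx.
pose L := \sum_(i <- s) p i x.
have p_gt0 : 0 < p i0 x by rewrite lt_max subr_gt0 gi0 orbT.
have sum_gt0 (f : I -> R) : (forall i, 0 <= f i) -> 0 < f i0 ->
    0 < \sum_(i <- s) f i.
  move=> f0 fi0; rewrite lt_neqAle sumr_ge0// andbT eq_sym psumr_neq0//.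
  by apply/hasP; exists i0.
have L0 : 0 < L by exact: sum_gt0.
have pg i : p i x * (g i x - c) = p i x ^+ 2.
  by rewrite /p /Num.max; case: ifPn; rewrite ?mul0r ?expr2 ?mul0r.
have first_order y : K y -> 0 <= \sum_(i <- s) p i x * (g i y - g i x).
  move=> Ky.
  apply: (@ge0_of_quadratic _ (\sum_(i <- s) (g i y - g i x) ^+ 2)).
    by apply: sumr_ge0 => i _; exact: sqr_ge0.
  move=> t /andP[t0 t1].
  have [|z Kz gz] := @K_convex x y t Kx Ky; first by rewrite (ltW t0).
  rewrite -(lerD2l (F x)) addr0.
  (* With u = g i x - c and d = g i y - g i x, the positive part of u + t d is at most the absolute
     value of u_+ + t d. Hence [F z] is bounded by a quadratic polynomial in [t] with constant term
     [F x], whose linear coefficient is twice the sum in the goal. *)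
  apply: (le_trans (Fmin _ (mem_set Kz))).
  rewrite /F !mulr_sumr -!big_split/= big_seq [leRHS]big_seq.
  apply: ler_sum => i /sD Di.
  have -> : p i x ^+ 2 + (2 * t * (p i x * (g i y - g i x)) +
      t ^+ 2 * (g i y - g i x) ^+ 2) = (p i x + t * (g i y - g i x)) ^+ 2.
    by rewrite !expr2; lra.
  have := p0 i x; rewrite /p gz//.
  set u := g i x - c; set d := g i y - g i x.
  have -> : (1 - t) * g i x + t * g i y - c = u + t * d by rewrite /u /d; lra.
  rewrite /Num.max; case: ifPn => [_|]; case: ifPn => // ud;
    rewrite ?expr0n/= ?sqr_ge0// -leNgt => u0 _.
  by rewrite add0r ler_sqr ?nnegrE ?(ltW ud)//; lra.
have [j Dj gj] := D_convex sD (w := fun i => p i x / L)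
  (fun i => divr_ge0 (p0 i x) (ltW L0))
  (etrans (esym (mulr_suml _ _ _ _)) (divff (lt0r_neq0 L0))).
have [y Ky gjy] := gc j Dj.
suff : c < g j y by rewrite ltNge gjy.
rewrite gj//.
have -> : \sum_(i <- s) p i x / L * g i y =
    (\sum_(i <- s) p i x * g i y) / L.
  by rewrite mulr_suml; apply: eq_bigr => i _; rewrite mulrAC.
(* [L * (g j y - c)] is the first-order sum plus the sum of the [p i x ^+ 2], and the latter is
   positive because of [i0]. *)
rewrite ltr_pdivlMr// -subr_gt0 mulr_sumr -sumrB.
have := first_order y Ky.
have : 0 < \sum_(i <- s) p i x ^+ 2.
  by apply: sum_gt0 => [i|]; rewrite ?sqr_ge0// exprn_gt0.
move=> /ltr_wpDr/[apply]; rewrite -big_split/=.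
congr (_ < _); apply: eq_bigr => i _.
by rewrite -pg; lra.
Qed.

(** By [finite_minimax] the closed sublevel sets in [K] have the finite intersection property, and
    compactness gives a common point. Fixing a level [c] avoids writing infima and suprema over [K]
    and [D]. *)
Lemma compact_convex_minimax (c : R) :
  (forall i, D i -> exists2 x, K x & g i x <= c) ->
  exists2 x, K x & forall i, D i -> g i x <= c.
Proof.
move=> gc; pose f i := K `&` [set x | g i x <= c].
have [[i0 Di0]|D0] := pselect (D !=set0); last first.
  by have [x Kx] := K0; exists x => // i Di; exfalso; apply: D0; exists i.
have finIf : finI D f.
  move=> D' D'D.
  have [|x Kx xc] := @finite_minimax c (enum_fset D') _ gc.
    by move=> i /D'D /set_mem.
  by exists x => i /= iD'; split => //; exact: xc.
(* The set [f i0] shows that the filter contains [K]; this is where [D] must be nonempty. *)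
have [|x [Kx clx]] := compactK (finI_filter finIf).
  by exists (f i0); [exact: finI_from1|move=> ? []].
exists x => // i Di.
have : closed [set x | g i x <= c].
  by apply: (@preimage_closed _ _ (g i) [set y | y <= c]) => [y _|];
    [exact: g_continuous|exact: closed_le].
apply => B nB; apply: clx => //.
by exists (f i); [exact: finI_from1|move=> ? []].
Qed.

End minimax.

(** * Approximation of Borel sets by continuous tests *)

Section borel_approximation.
Context {R : realType} {T : pmetricType R}.

Lemma borel_open (U : set T) : open U -> measurable (U : set (borel T)).
Proof. exact: sub_sigma_algebra. Qed.

Lemma continuous_borel_measurable (f : T -> R) : continuous f ->
  measurable_fun setT (f : borel T -> R).
Proof.
move=> /continuousP cf; apply: (measurability _ (RGenOpens.measurableE R)).
move=> _ [_ [a [b ->] <-]]; rewrite setTI.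
by apply: borel_open; apply: cf; exact: interval_open.
Qed.

(** [F n] is the complement of an open 1 / (n + 1)-neighborhood of the complement of [U]. A point of
    [U] has a ball inside [U], so it escapes these neighborhoods once the radius is small. *)
Lemma open_inner_approximation (U : set T) : open U ->
  exists F : (set T)^nat, [/\ forall n, closed (F n), nondecreasing_seq F &
    \bigcup_n F n = U].
Proof.
move=> oU.
pose V n : set T := \bigcup_(y in ~` U) (ball y n.+1%:R^-1)°.
exists (fun n => ~` V n); split.
- move=> n; apply: open_closedC; apply: bigcup_open => y _.
  exact: open_interior.
- apply/nondecreasing_seqP => n; apply/subsetPset; apply: subsetC.
  apply: subset_bigcup => y _; apply: interiorS; apply: le_ball.
  by rewrite lef_pV2 ?posrE// ler_nat.
- rewrite -setC_bigcap; apply: (canLR (@setCK T)); rewrite eqEsubset; split.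
    move=> x Vx Ux.
    have /nbhs_ballP[e /= e0 eU] : nbhs x U by exact: open_nbhs_nbhs.
    have [n _ /(_ n (leqnn n)) ne] := near_infty_natSinv_lt (PosNum e0).
    have [y nUy /interior_subset yx] := Vx n I.
    apply: nUy; apply: eU; apply: ball_sym.
    by apply: le_ball yx; exact: ltW.
  move=> y nUy n _; exists y => //.
  by apply: nbhsx_ballx; rewrite invr_gt0.
Qed.

Variable m : {measure set (borel T) -> \bar R}.
Hypothesis m_fin : (m setT < +oo)%E.

Definition continuous_test (phi : T -> R) :=
  continuous phi /\ forall x, 0 <= phi x <= 1.

(** Measurability is included so that this class of sets can itself be shown to be a
    sigma-algebra. *)
Definition L1_approximable (A : set T) :=
  measurable (A : set (borel T)) /\ forall e : R, 0 < e ->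
    exists2 phi, continuous_test phi &
      (\int[m]_x `|\1_A x - phi x|%:E < e%:E)%E.

Let measurable_err (A : set T) (phi : T -> R) : measurable (A : set (borel T)) ->
  continuous phi ->
  measurable_fun setT ((fun x => `|\1_A x - phi x|%:E) : borel T -> \bar R).
Proof.
move=> mA cphi; apply/measurable_EFinP; apply: measurableT_comp => //.
apply: measurable_funB; first exact: measurable_indic.
exact: continuous_borel_measurable.
Qed.

Let measurable_1 (A : set T) : measurable (A : set (borel T)) ->
  measurable_fun setT ((fun x => (\1_A x : R)%:E) : borel T -> \bar R).
Proof. by move=> mA; apply/measurable_EFinP; exact: measurable_indic. Qed.

Let indicD (A : set T) x : (\1_A x = 1 :> R) /\ A x \/ (\1_A x = 0 :> R) /\ ~ A x.
Proof.
rewrite indicE; have [Ax|nAx] := pselect (A x).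
  by left; rewrite mem_set.
by right; rewrite memNset.
Qed.

Let m_fin_num (A : set T) : measurable (A : set (borel T)) -> m A \is a fin_num.
Proof.
move=> mA; rewrite ge0_fin_numE//; apply: le_lt_trans m_fin.
by apply: (le_measure m (mem_set mA) (mem_set measurableT)) => x.
Qed.

(** Continuity from above along [A \ B n], which decreases to the empty set; this relies on [m]
    being finite. *)
Let small_measure (A : set T) (B : (set T)^nat) (e : R) : 0 < e ->
  measurable (A : set (borel T)) ->
  (forall n, measurable (B n : set (borel T))) -> nondecreasing_seq B ->
  \bigcup_n B n = A -> exists n, (m (A `\` B n) < e%:E)%E.
Proof.
move=> e0 mA mB ndB BA.
have mD n : measurable (A `\` B n : set (borel T)) by exact: measurableD.
have D0 : \bigcap_n (A `\` B n) = set0.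
  apply/seteqP; split => // x Dx; have [Ax _] := Dx 0%N I.
  by move: Ax; rewrite -BA => -[n _ Bx]; have [] := Dx n I.
have : m \o (fun n => A `\` B n) @ \oo --> m (\bigcap_n (A `\` B n)).
  apply: nonincreasing_cvg_mu => //.
  - by rewrite -ge0_fin_numE//; exact: m_fin_num.
  - by rewrite D0.
  - move=> i j ij; apply/subsetPset; apply: setDS; apply/subsetPset; exact: ndB.
rewrite D0 measure0 => /fine_cvgP[_ /cvgrPdist_lt/(_ _ e0)[n _ /(_ n (leqnn n))]].
rewrite /= sub0r normrN ger0_norm ?fine_ge0// => ne; exists n.
by rewrite -[ltLHS]fineK ?lte_fin//; exact: m_fin_num.
Qed.

(** Choose a closed [F n] inside [U] with [U \ F n] of measure below [e]. A Urysohn function equal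
    to 0 off [U] and to 1 on [F n] differs from the indicator of [U] only on [U \ F n], and by at
    most 1. *)
Let approximable_open (U : set T) : open U -> L1_approximable U.
Proof.
move=> oU; have mU := borel_open oU; split => // e e0.
have [F [clF ndF FU]] := open_inner_approximation oU.
have mF n : measurable (F n : set (borel T)).
  by rewrite -(setCK (F n)); apply: measurableC; apply: borel_open; exact: closed_openC.
have [n ne] := small_measure e0 mU mF ndF FU.
have FnU : F n `<=` U by rewrite -FU; exact: bigcup_sup.
have : uniform_separator (~` U) (F n).
  have /(@normal_separatorP R) := @pseudometric_normal R T; apply => //.
    exact: open_closedC.
  by apply/seteqP; split => // x [/= nUx /FnU].
move=> /(@uniform_separatorP T R)[phi [cphi phi01 phi0 phi1]].
have phiI x : 0 <= phi x <= 1.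
  by have := phi01 (phi x); rewrite /= in_itv/=; apply; exists x.
exists phi; first by [].
apply: le_lt_trans ne.
rewrite -[U `\` F n]setIT -integral_indic//; last exact: measurableD.
apply: ge0_le_integral => //.
- exact: measurable_err.
- by apply: measurable_1; exact: measurableD.
- move=> x _; rewrite lee_fin.
  have [[-> [Ux nFx]]|[-> nD]] := indicD (U `\` F n) x.
    have [[-> _]|[_ //]] := indicD U x.
    by have := phiI x; rewrite ler_norml; lra.
  have [[-> Ux]|[-> nUx]] := indicD U x.
    have Fx : F n x by apply: contrapT => nFx; apply: nD.
    by rewrite (phi1 (phi x))//= ?subrr ?normr0//; exists x.
  by rewrite (phi0 (phi x))//= ?subrr ?normr0//; exists x.
Qed.

Let approximableC (A : set T) : L1_approximable A -> L1_approximable (~` A).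
Proof.
move=> [mA hA]; split=> [|e /hA[phi [cphi phi01] phie]]; first exact: measurableC.
exists (fun x => 1 - phi x).
  split=> [x|x]; last by have := phi01 x; lra.
  by apply: cvgB; [exact: cvg_cst|exact: cphi].
congr (_ < _)%E: phie; apply: eq_integral => x _; congr EFin.
have -> : \1_(~` A) x = 1 - \1_A x :> R.
  have [[-> Ax]|[-> nAx]] := indicD A x; have [[-> h]|[-> h]] := indicD (~` A) x;
    by [case: h|rewrite ?subrr ?subr0].
by rewrite opprB addrCA addrAC subrr add0r distrC.
Qed.

(** The indicator of a union is the maximum of the indicators, and the error of a maximum is at most
    the sum of the errors. *)
Let approximableU (A B : set T) :
  L1_approximable A -> L1_approximable B -> L1_approximable (A `|` B).
Proof.
move=> [mA hA] [mB hB]; split=> [|e e0]; first exact: measurableU.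
have e20 : 0 < e / 2 by rewrite divr_gt0.
have [phi [cphi phi01] phie] := hA _ e20.
have [psi [cpsi psi01] psie] := hB _ e20.
exists (fun x => Num.max (phi x) (psi x)).
  split=> [x|x].
    apply: (@continuous_max _ _ phi psi); [exact: cphi|exact: cpsi].
  by rewrite /Num.max; case: ifPn.
apply: (@le_lt_trans _ _ (\int[m]_x `|\1_A x - phi x|%:E +
  \int[m]_x `|\1_B x - psi x|%:E)%E); last first.
  by rewrite [e]splitr EFinD; exact: lteD.
rewrite -ge0_integralD//; [|exact: measurable_err|exact: measurable_err].
apply: ge0_le_integral => //.
- apply: measurable_err; first exact: measurableU.
  move=> x; apply: (@continuous_max _ _ phi psi); [exact: cphi|exact: cpsi].
- by apply: emeasurable_funD; exact: measurable_err.
- move=> x _; rewrite -EFinD lee_fin.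
  have := phi01 x; have := psi01 x.
  have := ler_norm (\1_A x - phi x); have := ler_norm (\1_B x - psi x).
  have := normr_ge0 (\1_A x - phi x); have := normr_ge0 (\1_B x - psi x).
  have := ler_norm (- (\1_A x - phi x)); have := ler_norm (- (\1_B x - psi x)).
  rewrite !normrN ler_norml /Num.max.
  have [[-> ]|[-> ]] := indicD A x; have [[-> ]|[-> ]] := indicD B x;
    have [[-> ]|[-> ]] := indicD (A `|` B) x => //=; case: ifPn => *; try lra; exfalso; tauto.
Qed.

(** The approximable sets form a sigma-algebra containing the open sets. A countable union is first
    replaced by a finite one, at a cost in measure below [e / 2] by [small_measure]. *)
Lemma borel_approximable (A : set (borel T)) : measurable A -> L1_approximable A.
Proof.
move: A; suff : sigma_algebra setT L1_approximable.
  by move=> sL;  apply: smallest_sub => // U; exact: approximable_open.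
split.
- by apply: approximable_open; exact: open0.
- by move=> A; rewrite setTD; exact: approximableC.
- move=> A hA.
  have mA n : measurable (A n : set (borel T)) by have [] := hA n.
  have mUA : measurable (\bigcup_n A n : set (borel T)).
    exact: bigcup_measurable.
  split => // e e0.
  pose B n := \big[setU/set0]_(i < n.+1) A i.
  have hB n : L1_approximable (B n).
    rewrite /B; apply: big_ind => [| |i _]; [|exact: approximableU|exact: hA].
    by apply: approximable_open; exact: open0.
  have mB n : measurable (B n : set (borel T)) by have [] := hB n.
  have BA : \bigcup_n B n = \bigcup_n A n by rewrite bigcup_bigsetU_bigcup.
  have e20 : 0 < e / 2 by rewrite divr_gt0.
  have [n ne] : exists n, (m (\bigcup_n A n `\` B n) < (e / 2)%:E)%E.
    apply: small_measure => // i j ij.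
    by apply/subsetPset; exact: (@subset_bigsetU _ A i.+1 j.+1).
  have [_ /(_ _ e20)[phi [cphi phi01] phie]] := hB n.
  exists phi => //.
  apply: (@le_lt_trans _ _ (\int[m]_x (\1_(\bigcup_n A n `\` B n) x : R)%:E +
    \int[m]_x `|\1_(B n) x - phi x|%:E)%E); last first.
    rewrite [e]splitr EFinD; apply: lteD => //.
    by rewrite integral_indic ?setIT//; exact: measurableD.
  rewrite -ge0_integralD//; last 2 first.
  - by apply: measurable_1; exact: measurableD.
  - exact: measurable_err.
  apply: ge0_le_integral => //.
  - exact: measurable_err.
  - apply: emeasurable_funD; last exact: measurable_err.
    by apply: measurable_1; exact: measurableD.
  - move=> x _; rewrite -EFinD lee_fin.
    have [[-> [UAx nBx]]|[-> nD]] := indicD (\bigcup_n A n `\` B n) x.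
      have [[-> _]|[_ //]] := indicD (\bigcup_n A n) x.
      have [[_ //]|[-> _]] := indicD (B n) x.
      by rewrite sub0r normrN; apply: le_trans (ler_normB _ _) _; rewrite normr1.
    rewrite add0r.
    suff -> : \1_(\bigcup_n A n) x = \1_(B n) x :> R by [].
    have [[-> UAx]|[-> nUA]] := indicD (\bigcup_n A n) x;
      have [[-> Bx]|[-> nBx]] := indicD (B n) x => //; exfalso.
      by apply: nD.
    by apply: nUA; rewrite -BA; exists n.
Qed.

End borel_approximation.

(** * Finitely additive set functions *)

(** A supremum of topologies refines each of them. Both [weak_convergence] and [weak_star] are
    suprema of this shape. *)
Lemma sup_initial_continuous (S : choiceType) (I : Type) (U : topologicalType)
    (F : I -> S -> U) (i : I) :
  continuous (F i : sup_topology (fun j =>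
    Topological.class (initial_topology (F j))) -> U).
Proof.
move=> x; apply: cvg_trans (@initial_continuous _ _ (F i) x).
apply: cvg_app.
have [+ _] := @cvg_sup S I (fun j => Topological.class (initial_topology (F j)))
  (nbhs x) x (nbhs_filter x).
by move=> /(_ (fun A nA => nA) i).
Qed.

Section finitely_additive.
Context d (T : measurableType d) (R : realType).
Implicit Types (mu nu : ba T R) (A B : set T).

Lemma baB mu nu A : (mu - nu) A = mu A - nu A.
Proof. by []. Qed.

Lemma ba_setU mu A B : measurable A -> measurable B -> A `&` B = set0 ->
  mu (A `|` B) = mu A + mu B.
Proof. by have [_ + _] := ba_prop mu; exact. Qed.

Lemma ba_setC mu A : measurable A -> mu (~` A) = mu setT - mu A.
Proof.
move=> mA; rewrite -(setUv A) ba_setU ?setICr//; last exact: measurableC.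
by rewrite addrAC subrr add0r.
Qed.

Lemma tv_norm_setC mu A : measurable A -> `|mu A| + `|mu (~` A)| <= tv_norm mu.
Proof.
move=> mA; pose F (i : 'I_2) := if i == ord0 then A else ~` A.
have pF : finite_mpartition F.
  split.
  - by move=> i; rewrite /F; case: ifP => // _; exact: measurableC.
  - apply/trivIsetP => i j _ _; rewrite /F.
    case: i j => [[|[|//]]] i [[|[|//]]] j //= _; first exact: setICr.
    exact: setICl.
  - apply/seteqP; split=> // x _.
    have [Ax|nAx] := pselect (A x); first by exists ord0.
    by exists (Ordinal (ltnSn 1)).
by have := tv_sum_le mu pF; rewrite big_ord_recl big_ord1.
Qed.

(** As the total masses agree, [mu - nu] takes opposite values on [A] and its complement. The
    two-block partition therefore counts the difference twice, which the factor 1/2 in [tv_dist]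
    compensates. *)
Lemma tv_dist_ge mu nu A : mu setT = nu setT -> measurable A ->
  nu A - mu A <= tv_dist mu nu.
Proof.
move=> munu mA; have := tv_norm_setC (mu - nu) mA.
rewrite !baB !ba_setC// munu /tv_dist -[ `|mu - nu| ]/(tv_norm (mu - nu)).
have := ler_norm (- (mu A - nu A)).
have := ler_norm (nu setT - mu A - (nu setT - nu A)).
by rewrite normrN; lra.
Qed.

(** Group the blocks of a partition by the sign of [mu - nu]. The negative blocks contribute
    [nu - mu] of their union; the nonnegative ones contribute [nu - mu] of the complement of theirs.
    Each part is at most [c]. *)
Lemma tv_dist_le mu nu (c : R) : mu setT = nu setT ->
  (forall A, measurable A -> nu A - mu A <= c) -> tv_dist mu nu <= c.
Proof.
move=> munu h; rewrite /tv_dist ler_pdivrMl//.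
apply: tv_norm_le => n F [mF tF _].
rewrite (bigID (fun i => 0 <= (mu - nu) (F i)))/= mulrDl mul1r lerD//.
  rewrite (eq_bigr (fun i => (mu - nu) (F i))) => [|i /ger0_norm//].
  rewrite -ba_bigsetU// baB; set A := \big[_/_]_(_ <- _ | _) _.
  have mA : measurable A by exact: bigsetU_measurable.
  by have := h _ (measurableC mA); rewrite !ba_setC// munu; lra.
rewrite (eq_bigr (fun i => - (mu - nu) (F i))); last first.
  by move=> i; rewrite -ltNge => /ltr0_norm.
rewrite sumrN -ba_bigsetU// baB opprB; apply: h.
exact: bigsetU_measurable.
Qed.

Section fibers.
Variable s : T -> R.
Hypothesis ms : measurable_fun setT s.

Let mfiber r : measurable (s @^-1` [set r]).
Proof. by rewrite -[X in measurable X]setTI; exact: ms. Qed.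

Let mfibers (l : seq R) : measurable [set x | s x \in l].
Proof.
elim: l => [|r l ih]; first by rewrite (_ : mkset _ = set0)//; apply/seteqP; split.
rewrite (_ : mkset _ = s @^-1` [set r] `|` [set x | s x \in l]).
  exact: measurableU.
apply/seteqP; split => x /=; rewrite inE.
  by move=> /orP[/eqP|]; [left|right].
by move=> [->|->]; rewrite ?eqxx ?orbT.
Qed.

Lemma ba_sum_fibers mu (l : seq R) B : uniq l -> measurable B ->
  \sum_(r <- l) mu (s @^-1` [set r] `&` B) = mu ([set x | s x \in l] `&` B).
Proof.
move=> + mB; elim: l => [_|r l ih /= /andP[rl ul]].
  by rewrite big_nil (_ : _ `&` B = set0) ?ba_set0//; apply/seteqP; split => // x [].
rewrite big_cons ih// -ba_setU; [|exact: measurableI|exact: measurableI|].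
  congr (mu _); apply/seteqP; split => x /=; rewrite inE.
    by move=> [[-> Bx]|[-> Bx]]; rewrite ?eqxx ?orbT.
  by move=> [/orP[/eqP|]]; [left|right].
by apply/seteqP; split => // x [[/= xr _] [xl _]]; rewrite xr in xl; rewrite xl in rl.
Qed.

(** The sets in the sum need not cover the space, so they are not a [finite_mpartition]. Splitting
    them by the sign of [mu] gives the bound with a harmless constant 2. *)
Lemma ba_sum_fibers_le mu (l : seq R) B (w : R -> R) (e : R) : uniq l ->
  measurable B -> 0 <= e -> (forall x, B x -> `|w (s x)| <= e) ->
  `|\sum_(r <- l) w r * mu (s @^-1` [set r] `&` B)| <= e * (2 * tv_norm mu).
Proof.
move=> ul mB e0 we.
have mu_le A : measurable A -> `|mu A| <= tv_norm mu.
  move=> mA; apply: le_trans (tv_norm_setC mu mA).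
  by rewrite lerDl.
have sum_le (p : pred R) :
    `|\sum_(r <- l | p r) mu (s @^-1` [set r] `&` B)| <= tv_norm mu.
  rewrite -big_filter ba_sum_fibers ?filter_uniq//.
  by apply: mu_le; exact: measurableI.
apply: le_trans (ler_norm_sum _ _ _) _.
apply: (@le_trans _ _ (\sum_(r <- l) e * `|mu (s @^-1` [set r] `&` B)|)).
  apply: ler_sum => r _; rewrite normrM.
  (* No bound on [w r] is known when the fiber misses [B], but [mu] then vanishes there. *)
  have [->|/set0P[x [/= sx Bx]]] := eqVneq (s @^-1` [set r] `&` B) set0.
    by rewrite ba_set0 normr0 !mulr0.
  by apply: ler_wpM2r => //; rewrite -sx; exact: we.
rewrite -mulr_sumr; apply: ler_wpM2l => //.
rewrite (bigID (fun r => 0 <= mu (s @^-1` [set r] `&` B)))/= mulrDl mul1r lerD//.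
  rewrite (eq_bigr (fun r => mu (s @^-1` [set r] `&` B))) => [|r /ger0_norm//].
  exact: le_trans (ler_norm _) (sum_le _).
rewrite (eq_bigr (fun r => - mu (s @^-1` [set r] `&` B))); last first.
  by move=> r; rewrite -ltNge => /ltr0_norm.
by rewrite sumrN; apply: le_trans (ler_norm _) _; rewrite normrN.
Qed.

End fibers.

(** The function [s] is within [e] of 1 on [A] and of 0 off [A]. Cutting each fiber along [A] turns
    the difference into two sums with weights [r - 1] and [r], each handled by
    [ba_sum_fibers_le]. *)
Lemma ba_sint_indic_near mu A (s : T -> R) (e : R) : measurable A -> simple s ->
  (forall x, `|\1_A x - s x| <= e) ->
  `|ba_sint mu s - mu A| <= e * (4 * tv_norm mu).
Proof.
move=> mA [ms fs] se; have mCA := measurableC mA.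
have e0 : 0 <= e by exact: le_trans (normr_ge0 _) (se point).
rewrite /ba_sint fsbig_finite//=; set l := enum_fset _.
have ul : uniq l by exact: fset_uniq.
have sl : [set x | s x \in l] = setT.
  apply/seteqP; split => // x _ /=.
  by rewrite [_ \in _](in_fset_set fs) mem_set//; exists x.
have mfiber r : measurable (s @^-1` [set r]).
  by rewrite -[X in measurable X]setTI; exact: ms.
have -> : \sum_(r <- l) r * mu (s @^-1` [set r]) - mu A =
    \sum_(r <- l) (r - 1) * mu (s @^-1` [set r] `&` A) +
    \sum_(r <- l) r * mu (s @^-1` [set r] `&` ~` A).
  rewrite -[X in _ - mu X]setTI -sl -ba_sum_fibers// -sumrB -big_split/=.
  apply: eq_bigr => r _.
  have -> : mu (s @^-1` [set r]) =
      mu (s @^-1` [set r] `&` A) + mu (s @^-1` [set r] `&` ~` A).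
    rewrite -ba_setU -?setIUr ?setUv ?setIT//; [exact: measurableI..|].
    by rewrite setIACA setICr setI0.
  lra.
have -> : e * (4 * tv_norm mu) = e * (2 * tv_norm mu) + e * (2 * tv_norm mu).
  by rewrite -mulrDr -mulrDl -natrD.
apply: le_trans (ler_normD _ _) _; apply: lerD.
  apply: (@ba_sum_fibers_le s ms mu l A (fun r => r - 1)) => // x Ax.
  by have := se x; rewrite indicE mem_set// distrC.
apply: (@ba_sum_fibers_le s ms mu l (~` A) id) => // x nAx.
by have := se x; rewrite indicE memNset// sub0r normrN.
Qed.

Lemma indic_simple A : measurable A -> simple (\1_A : T -> R).
Proof.
move=> mA; split; first exact: measurable_indic.
apply: (@sub_finite_set _ _ [set 0; 1]); last exact: finite_set2.
by move=> _ [x _ <-]; rewrite indicE; case: (_ \in _); [right|left].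
Qed.

(** The indicator is itself simple, so the filter in [ba_int] is proper, and [ba_sint_indic_near]
    identifies the limit. *)
Lemma ba_int_indic mu A : measurable A -> ba_int mu (\1_A) = mu A.
Proof.
move=> mA; rewrite /ba_int.
have FF : ProperFilter (within (@simple _ T R) (nbhs (\1_A : {uniform T -> R}))).
  split; last exact: within_filter.
  by rewrite /within/= => /nbhs_singleton; apply; exact: indic_simple.
apply: cvg_lim; first exact: Rhausdorff.
apply/cvgrPdist_le => e e0; rewrite near_withinE.
(* The summand 1 keeps [k] positive when [mu] is zero. *)
pose k := 4 * tv_norm mu + 1.
have tv0 : 0 <= tv_norm mu by exact: (normr_ge0 mu).
have k0 : 0 < k by rewrite /k; lra.
apply/uniform_nbhs; exists [set xy | ball xy.1 (e / k) xy.2]; split.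
  by rewrite -entourage_ballE; exists (e / k) => //=; rewrite divr_gt0.
move=> s /= near_s simple_s.
rewrite distrC; apply: le_trans (ba_sint_indic_near mu mA simple_s _) _.
  by move=> x; apply: ltW; exact: near_s.
by rewrite -mulrA ler_piMr ?(ltW e0)// ler_pdivrMl// /k; lra.
Qed.

Lemma weak_star_eval_continuous A : measurable A ->
  continuous ((fun mu : ba T R => mu A : R) : weak_star T R -> R).
Proof.
move=> mA mu.
have bA : bounded_measurable (\1_A : T -> R).
  split; first exact: measurable_indic.
  exists 1; split => // x x1 t _; rewrite /= indicE.
  by apply: le_trans (ltW x1); case: (_ \in _); rewrite ?normr1 ?normr0.
have -> : (fun mu : ba T R => mu A : R) = fun mu => ba_int mu (\1_A).
  by apply/funext => nu; rewrite ba_int_indic.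
exact: (@sup_initial_continuous _ _ _
  (fun (f : set_type (@bounded_measurable _ T R)) (mu : ba T R) =>
    ba_int mu (val f)) (SigSub (mem_set bA))).
Qed.

End finitely_additive.

(** * Integrals of tests *)

Section tests.
Context d (T : measurableType d) (R : realType).
Implicit Types (P Q : probability T R) (phi : T -> R).

Lemma ba_of_probabilityE P A : measurable A ->
  ba_of_probability P A = fine (P A).
Proof. by move=> mA; rewrite /= /probability_fun asboolT. Qed.

Lemma ba_of_probability_setT P : ba_of_probability P setT = 1.
Proof. by rewrite ba_of_probabilityE// probability_setT. Qed.

Lemma bounded_integrable P (f : T -> R) (M : R) : measurable_fun setT f ->
  (forall x, `|f x| <= M) -> P.-integrable setT (EFin \o f).
Proof.
move=> mf fM; apply: measurable_bounded_integrable => //.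
  by rewrite -ge0_fin_numE// fin_num_measure.
by exists M; split; [exact: num_real|move=> x Mx t _]; exact: le_trans (fM t) (ltW Mx).
Qed.

Lemma test_integrable P phi : tests T R phi -> P.-integrable setT (EFin \o phi).
Proof.
move=> [mphi phi01]; apply: (@bounded_integrable _ _ 1) => // x.
by have /andP[p0 p1] := phi01 x; rewrite ger0_norm.
Qed.

Lemma Rintegral_indic P A : measurable A -> \int[P]_x \1_A x = fine (P A).
Proof. by move=> mA; rewrite /Rintegral integral_indic// setIT. Qed.

Lemma Rintegral_probability_cst P (c : R) : \int[P]_x (cst c x) = c.
Proof. by rewrite /cst Rintegral_cst//= probability_setT mulr1. Qed.

Lemma indic_test A : measurable A -> tests T R (\1_A).
Proof.
move=> mA; split=> [|x]; first exact: measurable_indic.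
by rewrite indicE; case: (_ \in _); rewrite lexx ler01.
Qed.

Lemma Rintegral_test_itv P phi : tests T R phi -> 0 <= \int[P]_x phi x <= 1.
Proof.
move=> tphi; have [mphi phi01] := tphi.
apply/andP; split; first by apply: Rintegral_ge0 => x _; case/andP: (phi01 x).
rewrite -[leRHS](Rintegral_probability_cst P).
apply: le_Rintegral => //; [exact: test_integrable|..].
  by apply: test_integrable; split=> // x; rewrite ler01 lexx.
by move=> x _; case/andP: (phi01 x).
Qed.

(** Integrability and value are proved together, since additivity at each step of the induction
    needs the integrability of the remaining sum. *)
Lemma Rintegral_sumZ P (I : eqType) (s : seq I) (w : I -> R) (f : I -> T -> R) :
  (forall i, i \in s -> tests T R (f i)) ->
  P.-integrable setT (EFin \o (fun x => \sum_(i <- s) w i * f i x)) /\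
  \int[P]_x (\sum_(i <- s) w i * f i x) = \sum_(i <- s) w i * \int[P]_x f i x.
Proof.
elim: s => [_|i s ih fs].
  under [X in EFin \o X]eq_fun do rewrite big_nil.
  under [in LHS]eq_Rintegral do rewrite big_nil.
  by rewrite big_nil Rintegral_cst// mul0r; split => //; exact: integrable0.
have [|fi es] := ih; first by move=> j js; apply: fs; rewrite inE js orbT.
have ti : P.-integrable setT (EFin \o f i).
  by apply: test_integrable; apply: fs; rewrite inE eqxx.
have wi : P.-integrable setT (EFin \o (fun x => w i * f i x)).
  by have := integrableZl measurableT (w i) ti; apply: eq_integrable.
under [X in EFin \o X]eq_fun do rewrite big_cons.
under [in LHS]eq_Rintegral do rewrite big_cons.
split; first by have := integrableD measurableT wi fi; apply: eq_integrable.
by rewrite RintegralD// es RintegralZl// big_cons.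
Qed.

(** The sum counts the integers from 1 to [n] that are at most [a]: it is the integer part of [a],
    truncated at [n]. *)
Lemma sum_le_nat_bounds (a : R) n : 0 <= a ->
  \sum_(k < n) (k.+1%:R <= a)%R%:R <= a /\
  (a <= n%:R -> a <= \sum_(k < n) (k.+1%:R <= a)%R%:R + 1).
Proof.
move=> a0; elim: n => [|n [ih1 ih2]].
  by rewrite big_ord0; split => // /le_trans; apply; rewrite add0r.
rewrite big_ord_recr/=; split.
  have [na|_] := boolP (n.+1%:R <= a); last by rewrite addr0.
  apply: le_trans na; rewrite -[n.+1]addn1 natrD lerD2r.
  have -> : n%:R = \sum_(k < n) 1 :> R by rewrite sumr_const card_ord.
  by apply: ler_sum => k _; case: (_ <= a); rewrite ?lexx ?ler01.
move=> an; have [/ih2 h|na] := leP a n%:R.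
  by apply: le_trans h _; rewrite lerD2r lerDl.
have -> : \sum_(k < n) (k.+1%:R <= a)%R%:R = n%:R :> R.
  rewrite -[n in RHS]card_ord -sumr_const; apply: eq_bigr => k _.
  by rewrite (le_trans _ (ltW na))// ler_nat.
apply: le_trans an _; rewrite -[n.+1]addn1 natrD lerD2r lerDl.
exact: ler0n.
Qed.

(* For a test [phi] this is, up to [1 / (n + 1)], the integral of [phi] in terms
   of finitely many values of the set function. *)
Definition staircase n phi (m : set T -> R) : R :=
  n.+1%:R^-1 * \sum_(k < n.+1) m [set x | k.+1%:R <= n.+1%:R * phi x].

Lemma measurable_step n phi k : tests T R phi ->
  measurable [set x | k%:R <= n%:R * phi x].
Proof.
move=> [mphi _]; rewrite -[X in measurable X]setTI.
have mf : measurable_fun setT (fun x => n%:R * phi x).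
  by apply: measurable_funM => //; exact: measurable_cst.
have := mf measurableT `[k%:R, +oo[%classic (measurable_itv _).
congr (measurable (_ `&` _)); apply/seteqP.
by split => x /=; rewrite in_itv/= andbT.
Qed.

(** The staircase is the integral of [phi] rounded down to a multiple of 1 / (n + 1), by
    [sum_le_nat_bounds] applied to [n.+1%:R * phi x]. *)
Lemma Rintegral_staircase P n phi : tests T R phi ->
  staircase n phi (ba_of_probability P) <= \int[P]_x phi x <=
  staircase n phi (ba_of_probability P) + n.+1%:R^-1.
Proof.
move=> tphi; have [mphi phi01] := tphi.
pose A k := [set x | k.+1%:R <= n.+1%:R * phi x].
have mA k : measurable (A k) by exact: measurable_step.
have n0 : 0 < n.+1%:R :> R by rewrite ltr0n.
pose w (k : 'I_n.+1) : R := n.+1%:R^-1.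
have [fi es] := @Rintegral_sumZ P _ (index_enum 'I_n.+1) w (fun k => \1_(A k))
  (fun k _ => indic_test (mA k)).
have -> : staircase n phi (ba_of_probability P) =
    \int[P]_x (\sum_(k < n.+1) w k * \1_(A k) x).
  rewrite es /staircase mulr_sumr; apply: eq_bigr => k _.
  by rewrite Rintegral_indic// -ba_of_probabilityE.
have bounds x : \sum_(k < n.+1) w k * \1_(A k) x <= phi x <=
    \sum_(k < n.+1) w k * \1_(A k) x + n.+1%:R^-1.
  have /andP[p0 p1] := phi01 x.
  have [] := @sum_le_nat_bounds (n.+1%:R * phi x) n.+1.
    by rewrite mulr_ge0// ltW.
  rewrite -mulr_sumr.
  under eq_bigr => k _.
    rewrite (_ : (_ <= _)%R%:R = \1_(A k) x); last first.
      by rewrite indicE /A; congr (nat_of_bool _)%:R;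
        apply/idP/idP => [h|/set_mem//]; apply/mem_set.
    over.
  move=> h1 h2; rewrite ler_pdivrMl// h1/=.
  rewrite -[X in _ + X]mulr1 -mulrDr ler_pdivlMl//; apply: h2.
  by rewrite ler_piMr// ltW.
apply/andP; split.
  apply: le_Rintegral => //; first exact: test_integrable.
  by move=> x _; case/andP: (bounds x).
have ic : P.-integrable setT (EFin \o cst (n.+1%:R^-1 : R)).
  apply: (@bounded_integrable _ _ n.+1%:R^-1); first exact: measurable_cst.
  by move=> x; rewrite ger0_norm// invr_ge0 ltW.
rewrite -[X in _ + X](Rintegral_probability_cst P) -RintegralD//.
apply: le_Rintegral => //; first exact: test_integrable.
  by have := integrableD measurableT fi ic; apply: eq_integrable.
by move=> x _; case/andP: (bounds x).
Qed.

(** The left-hand side is an average of differences on measurable sets, each bounded by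
    [tv_dist_ge]. Countable additivity does not enter, so the bound applies to limit points in
    [ba]. *)
Lemma staircase_tv_dist n phi (m1 m2 : ba T R) : tests T R phi ->
  m1 setT = m2 setT -> staircase n phi m2 - staircase n phi m1 <= tv_dist m1 m2.
Proof.
move=> tphi m12; rewrite -mulrBr ler_pdivrMl ?ltr0n// -sumrB.
rewrite mulr_natl -[n.+1 in leRHS]card_ord -sumr_const.
by apply: ler_sum => k _; apply: tv_dist_ge => //; exact: measurable_step.
Qed.

Lemma ler_addnatSinv (x y : R) : (forall n, x <= y + n.+1%:R^-1) -> x <= y.
Proof.
move=> h; apply/ler_addgt0Pr => e e0.
have [n _ /(_ n (leqnn n)) ne] := near_infty_natSinv_lt (PosNum e0).
by apply: le_trans (h n) _; rewrite lerD2l ltW.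
Qed.

Lemma test_tv_dist P Q phi : tests T R phi ->
  \int[Q]_x phi x - \int[P]_x phi x <=
  tv_dist (ba_of_probability P) (ba_of_probability Q).
Proof.
move=> tphi; apply: ler_addnatSinv => n.
have /andP[p1 p2] := Rintegral_staircase P n tphi.
have /andP[q1 q2] := Rintegral_staircase Q n tphi.
have := @staircase_tv_dist n phi (ba_of_probability P) (ba_of_probability Q) tphi.
rewrite !ba_of_probability_setT => /(_ erefl).
by move: (n.+1%:R^-1) p1 q2 => e; lra.
Qed.

(** Convexity in [ba] gives [Z] through its values on sets. Staircases are linear in these values,
    and letting [n] grow transfers the identity to integrals. *)
Lemma Rintegral_convex (S : set (probability T R)) P Q (t : R) :
  convex_set (in_ba S) -> S P -> S Q -> 0 <= t <= 1 ->
  exists2 Z, S Z & forall phi, tests T R phi ->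
    \int[Z]_x phi x = (1 - t) * \int[P]_x phi x + t * \int[Q]_x phi x.
Proof.
move=> cS SP SQ /andP[t0 t1].
have u0 : 0 <= 1 - t by rewrite subr_ge0.
have u1 : 1 - t <= 1 by rewrite gerBl.
(* The parameter of [conv] weighs its first argument, hence [1 - t] here. *)
have /set_mem[Z SZ ZE] := cS (ba_of_probability P) (ba_of_probability Q)
  (Itv01 u0 u1) (mem_set (imageP _ SP)) (mem_set (imageP _ SQ)).
exists Z => // phi tphi.
have E A : ba_of_probability Z A =
    (1 - t) * ba_of_probability P A + t * ba_of_probability Q A.
  by rewrite ZE /conv/= /unstable.onem subKr.
have SE n : staircase n phi (ba_of_probability Z) =
    (1 - t) * staircase n phi (ba_of_probability P) +
    t * staircase n phi (ba_of_probability Q).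
  rewrite /staircase !(mulrCA _ n.+1%:R^-1) -mulrDr; congr (_ * _).
  by rewrite !mulr_sumr -big_split/=; apply: eq_bigr => k _; exact: E.
have bounds n : `|\int[Z]_x phi x -
    ((1 - t) * \int[P]_x phi x + t * \int[Q]_x phi x)| <= n.+1%:R^-1.
  have /andP[z1 z2] := Rintegral_staircase Z n tphi.
  have /andP[p1 p2] := Rintegral_staircase P n tphi.
  have /andP[q1 q2] := Rintegral_staircase Q n tphi.
  have := ler_wpM2l u0 p1; have := ler_wpM2l u0 p2.
  have := ler_wpM2l t0 q1; have := ler_wpM2l t0 q2.
  by move: z1 z2; rewrite SE ler_norml; move: (n.+1%:R^-1) => e; lra.
apply/eqP; rewrite eq_le; apply/andP; split; apply: ler_addnatSinv => n;
  by have := bounds n; rewrite ler_norml; move: (n.+1%:R^-1) => e; lra.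
Qed.

End tests.

(** * Gaps of tests *)

Section closures.
Context d (T : measurableType d) (R : realType).

Lemma closure_le (W : topologicalType) (f : W -> R) (S : set W) (c : R) (x : W) :
  continuous f -> (forall y, S y -> f y <= c) -> closure S x -> f x <= c.
Proof.
move=> cf Sc Sx; rewrite leNgt; apply/negP => cfx.
have : nbhs x [set y | c < f y].
  by move: (cf x) => /cvgr_gt; apply.
by move=> /Sx[y [/Sc + /=]]; rewrite leNgt => /negP.
Qed.

Lemma tv_eval_continuous (A : set T) : measurable A ->
  continuous (fun m : ba T R => m A : R).
Proof.
move=> mA m B /nbhs_ballP[e /= e0 eB].
suff h m' : ball m e m' -> B (m' A : R).
  have := nbhsx_ballx m e e0; exact: (@filterS _ _ (nbhs_filter m)).
rewrite -ball_normE /= => mm'; apply: eB; rewrite -ball_normE /= -baB.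
apply: le_lt_trans mm'; apply: le_trans (tv_norm_setC (m - m') mA).
by rewrite lerDl.
Qed.

Lemma convex_hull_id (S : set (ba T R)) : convex_set S -> convex_hull S = S.
Proof. exact: smallest_id. Qed.

Lemma tv_dist_set_eq (S S' : set (ba T R)) (m0 m1 : ba T R) :
  S m0 -> S' m1 ->
  (forall m m', S m -> S' m' -> tv_dist m0 m1 <= tv_dist m m') ->
  tv_dist_set S S' = tv_dist m0 m1.
Proof.
move=> Sm0 Sm1 h; apply/eqP; rewrite eq_le; apply/andP; split.
  apply: ge_inf; first by exists (tv_dist m0 m1) => _ [m Sm [m' Sm' <-]]; exact: h.
  by exists m0 => //; exists m1.
apply: lb_le_inf; first by exists (tv_dist m0 m1), m0 => //; exists m1.
by move=> _ [m Sm [m' Sm' <-]]; exact: h.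
Qed.

(** The margin by which [phi] separates [P] from [Q]: separation by more than [eps] means
    [eps < gap P Q phi], and the risk of a test is [1 - gap P Q phi]. *)
Definition gap (P Q : set (probability T R)) (phi : T -> R) : R :=
  inf [set \int[nu]_x phi x | nu in Q] - sup [set \int[mu]_x phi x | mu in P].

Variables (P Q : set (probability T R)).
Hypotheses (P0 : P !=set0) (Q0 : Q !=set0).

Lemma le_sup_test phi mu : tests T R phi -> P mu ->
  \int[mu]_x phi x <= sup [set \int[mu]_x phi x | mu in P].
Proof.
move=> tphi Pmu; apply: ub_le_sup; last by exists mu.
by exists 1 => _ [nu _ <-]; case/andP: (Rintegral_test_itv nu tphi).
Qed.

Lemma ge_inf_test phi nu : tests T R phi -> Q nu ->
  inf [set \int[nu]_x phi x | nu in Q] <= \int[nu]_x phi x.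
Proof.
move=> tphi Qnu; apply: ge_inf; last by exists nu.
by exists 0 => _ [mu _ <-]; case/andP: (Rintegral_test_itv mu tphi).
Qed.

Lemma gap_le phi mu nu : tests T R phi -> P mu -> Q nu ->
  gap P Q phi <= \int[nu]_x phi x - \int[mu]_x phi x.
Proof. by move=> tphi Pmu Qnu; apply: lerB; [exact: ge_inf_test|exact: le_sup_test]. Qed.

Lemma le_gap phi c :
  (forall mu nu, P mu -> Q nu -> c <= \int[nu]_x phi x - \int[mu]_x phi x) ->
  c <= gap P Q phi.
Proof.
move=> h; rewrite lerBrDr -lerBrDl.
have [mu0 Pmu0] := P0; have [nu0 Qnu0] := Q0.
apply: ge_sup; first by exists (\int[mu0]_x phi x), mu0.
move=> _ [mu Pmu <-]; rewrite lerBrDr.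
apply: lb_le_inf; first by exists (\int[nu0]_x phi x), nu0.
by move=> _ [nu Qnu <-]; rewrite addrC -lerBrDr; exact: h.
Qed.

Lemma test_risk_gap phi : tests T R phi -> test_risk P Q phi = 1 - gap P Q phi.
Proof.
move=> tphi; rewrite /test_risk /gap opprB addrCA; congr (_ + _).
have E (nu : probability T R) : \int[nu]_x (1 - phi x) = 1 - \int[nu]_x phi x :> R.
  have t1 : tests T R (cst 1) by split=> // x; rewrite ler01 lexx.
  have := @RintegralB _ _ _ nu setT (cst 1) phi measurableT
    (test_integrable nu t1) (test_integrable nu tphi).
  by move=> ->; congr (_ - _); exact: Rintegral_probability_cst.
have [nu0 Qnu0] := Q0.
apply/eqP; rewrite eq_le; apply/andP; split.
  apply: ge_sup; first by exists (\int[nu0]_x (1 - phi x)), nu0.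
  by move=> _ [nu Qnu <-]; rewrite E lerD2l lerN2; exact: ge_inf_test.
rewrite lerBlDl -lerBlDr; apply: lb_le_inf.
  by exists (\int[nu0]_x phi x), nu0.
move=> _ [nu Qnu <-]; rewrite lerBlDl -lerBlDr -E; apply: ub_le_sup; last by exists nu.
exists 1 => _ [nu' _ <-]; rewrite E.
by case/andP: (Rintegral_test_itv nu' tphi) => h _; rewrite gerBl.
Qed.

(* Stated for an arbitrary topology making evaluations continuous, so as to
   apply both to the total variation and the weak-* topologies. *)
Lemma gap_tv_dist_closure (W : topologicalType) (v : W -> ba T R)
    (S S' : set W) (phi : T -> R) (m m' : W) :
  (forall A, measurable A -> continuous (fun w => v w A : R)) ->
  (forall w, S w -> in_ba P (v w)) -> (forall w, S' w -> in_ba Q (v w)) ->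
  tests T R phi -> closure S m -> closure S' m' ->
  gap P Q phi <= tv_dist (v m) (v m').
Proof.
move=> vc SP SQ tphi Sm Sm'.
(* Total mass 1 is preserved by closure, as evaluation at [setT] is continuous; [staircase_tv_dist]
   needs equal masses. *)
have vT (U : set W) (V : set (probability T R)) w :
    (forall w, U w -> in_ba V (v w)) -> closure U w -> v w setT = 1.
  move=> UV Uw; apply/eqP; rewrite eq_le; apply/andP; split.
    apply: (closure_le (vc _ measurableT) _ Uw) => y /UV[p _ <-].
    by rewrite ba_of_probability_setT.
  rewrite -lerN2; apply: (@closure_le _ (fun w => - (v w setT : R)) _ _ _ _ _ Uw).
    by move=> y; apply: cvgN; exact: vc.
  by move=> y /UV[p _ <-]; rewrite ba_of_probability_setT.
apply: ler_addnatSinv => n.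
have sc : continuous (fun w => staircase n phi (v w) : R).
  move=> w; apply: cvgM; first exact: cvg_cst.
  apply: cvg_big => [|k _]; first exact: add_continuous.
  by apply: vc; exact: measurable_step.
have h1 : staircase n phi (v m) <= sup [set \int[mu]_x phi x | mu in P].
  apply: (closure_le sc _ Sm) => y /SP[mu Pmu <-].
  apply: le_trans (le_sup_test tphi Pmu).
  by case/andP: (Rintegral_staircase mu n tphi).
(* Staircases underestimate integrals, so the bound on the side of [Q] loses 1 / (n + 1). *)
have h2 : - staircase n phi (v m') <=
    n.+1%:R^-1 - inf [set \int[nu]_x phi x | nu in Q].
  apply: (@closure_le _ (fun w => - staircase n phi (v w)) _ _ _ _ _ Sm').
    by move=> y; apply: cvgN; exact: sc.
  move=> y /SQ[nu Qnu <-].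
  have := ge_inf_test tphi Qnu; case/andP: (Rintegral_staircase nu n tphi) => _.
  by move: (n.+1%:R^-1) => e; lra.
have := @staircase_tv_dist _ _ _ n phi (v m) (v m') tphi.
rewrite (vT _ _ _ SP Sm) (vT _ _ _ SQ Sm') => /(_ erefl); rewrite /gap.
by move: (n.+1%:R^-1) h2 => e; lra.
Qed.

End closures.

(** * Existence of an optimal pair of measures *)

Section minimax_tests.
Context {R : realType} {T : pmetricType R}.

Lemma continuous_test_tests phi : @continuous_test R T phi -> tests (borel T) R phi.
Proof. by move=> [cphi phi01]; split => //; exact: continuous_borel_measurable. Qed.

Lemma continuous_test_bounded phi : @continuous_test R T phi ->
  bounded_continuous T phi.
Proof.
move=> [cphi phi01]; split => //; exists 1; split => // x x1 t _.
by apply: le_trans (ltW x1); case/andP: (phi01 t) => p0 p1; rewrite /= ger0_norm.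
Qed.

Lemma weak_eval_continuous phi : bounded_continuous T phi ->
  continuous ((fun mu : probability (borel T) R => \int[mu]_x phi x)
    : weak_convergence T -> R).
Proof.
move=> bphi.
exact: (@sup_initial_continuous _ _ _
  (fun (f : set_type (@bounded_continuous R T)) (mu : probability (borel T) R) =>
    \int[mu]_x (val f x)) (SigSub (mem_set bphi))).
Qed.

Lemma tv_dist_le_continuous_test (mu nu : probability (borel T) R) (c : R) :
  (forall phi, @continuous_test R T phi ->
    \int[nu]_x phi x - \int[mu]_x phi x <= c) ->
  tv_dist (ba_of_probability mu) (ba_of_probability nu) <= c.
Proof.
move=> h; apply: tv_dist_le => [|A mA]; first by rewrite !ba_of_probability_setT.
apply/ler_addgt0Pr => e e0; rewrite !ba_of_probabilityE//.
(* Approximating the indicator of [A] with respect to [mu + nu] controls both measures by one test,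
   with errors adding up to less than [e]. *)
have m_fin : (measure_add mu nu setT < +oo)%E.
  rewrite measure_addE; apply: lte_add_pinfty;
    by rewrite -ge0_fin_numE//; exact: fin_num_measure.
have [_ /(_ _ e0)[phi cphi phie]] := borel_approximable m_fin mA.
have tphi := continuous_test_tests cphi; have tA := indic_test R mA.
pose err x : R := `|\1_A x - phi x|.
(* The error takes values in [0, 1], so it is itself a test and its integrals are finite. *)
have terr : tests (borel T) R err.
  split=> [|x].
    apply: measurableT_comp => //.
    by apply: measurable_funB; [exact: measurable_indic|case: tphi].
  have [_ /(_ x)] := tphi; have [_ /(_ x)] := tA.
  by rewrite normr_ge0/= ler_norml; lra.
have err_le (p : probability (borel T) R) :
    `|fine (p A) - \int[p]_x phi x| <= \int[p]_x err x.
  rewrite -Rintegral_indic// -RintegralB//; [|exact: test_integrable..].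
  apply: le_normr_Rintegral => //.
  have := integrableB measurableT (test_integrable p tA) (test_integrable p tphi).
  exact: eq_integrable.
have errE (p : probability (borel T) R) :
    (\int[p]_x (err x)%:E)%E = (\int[p]_x err x)%:E.
  by rewrite fineK//; apply: integrable_fin_num => //; exact: test_integrable.
move: phie; rewrite ge0_integral_measure_add//; last first.
  by apply/measurable_EFinP; case: terr.
rewrite !errE -EFinD lte_fin.
have := err_le mu; have := err_le nu; have := h _ cphi.
by rewrite !ler_norml; lra.
Qed.

(** The minimax inequality is applied on [P * Q] at the level [c], the supremum of the gaps of
    continuous tests. It yields a pair whose distance is at most [c]. The supremum need not be
    attained, whence the slack [e]. *)
Lemma minimax_pair (P Q : set (probability (borel T) R)) :
  P !=set0 -> Q !=set0 ->
  convex_set (in_ba P) -> convex_set (in_ba Q) ->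
  compact (P : set (weak_convergence T)) ->
  compact (Q : set (weak_convergence T)) ->
  exists mu nu, [/\ P mu, Q nu & forall e, 0 < e ->
    exists2 phi, @continuous_test R T phi &
      tv_dist (ba_of_probability mu) (ba_of_probability nu) - e < gap P Q phi].
Proof.
move=> P0 Q0 cvP cvQ cpP cpQ.
pose X := (weak_convergence T * weak_convergence T)%type.
pose K : set X := (P : set (weak_convergence T)) `*` (Q : set (weak_convergence T)).
pose g (phi : T -> R) (x : X) : R :=
  \int[(x.2 : probability (borel T) R)]_y phi y -
  \int[(x.1 : probability (borel T) R)]_y phi y.
have K0 : K !=set0.
  by have [mu Pmu] := P0; have [nu Qnu] := Q0; exists (mu, nu).
have cK : compact K by exact: compact_setX.
have g_cont phi : @continuous_test R T phi -> continuous (g phi).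
  move=> /continuous_test_bounded/weak_eval_continuous cphi [mu nu].
  pose E (p : weak_convergence T) := \int[(p : probability (borel T) R)]_y phi y.
  have cE : continuous E by [].
  have c2 : {for (mu, nu), continuous (E \o snd : X -> R)}.
    by apply: continuous_comp; [exact: cvg_snd|exact: cE].
  have c1 : {for (mu, nu), continuous (E \o fst : X -> R)}.
    by apply: continuous_comp; [exact: cvg_fst|exact: cE].
  exact: (cvgB c2 c1).
have test0 : @continuous_test R T (cst 0).
  by split=> [|x]; [exact: cst_continuous|rewrite lexx ler01].
pose c := sup [set gap P Q phi | phi in @continuous_test R T].
have gap_sup : has_sup [set gap P Q phi | phi in @continuous_test R T].
  split; first by exists (gap P Q (cst 0)), (cst 0).
  have [mu Pmu] := P0; have [nu Qnu] := Q0.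
  exists 1 => _ [phi /continuous_test_tests tphi <-].
  apply: le_trans (gap_le tphi Pmu Qnu) _.
  have /andP[_ h1] := Rintegral_test_itv nu tphi.
  by have /andP[h2 _] := Rintegral_test_itv mu tphi; lra.
have [[mu nu] [/= Pmu Qnu] h] : exists2 x, K x & forall phi,
    @continuous_test R T phi -> g phi x <= c.
  apply: (compact_convex_minimax K0 cK g_cont).
  - move=> s w sD w0 w1.
    have ts i : i \in s -> tests (borel T) R i by move=> /sD/continuous_test_tests.
    exists (fun x => \sum_(i <- s) w i * i x).
      split=> [x|x].
        have -> : (fun x => \sum_(i <- s) w i * i x) =
            fun x => \sum_(i <- s | i \in s) w i * i x.
          by apply/funext => y; rewrite big_seq.
        apply: cvg_big => [|i /sD[ci _]].
          exact: add_continuous.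
        by apply: cvgM; [exact: cvg_cst|exact: ci].
      rewrite -w1 big_seq [X in _ <= _ <= X]big_seq; apply/andP; split.
        apply: sumr_ge0 => i /sD[_ /(_ x)/andP[i0 _]].
        exact: mulr_ge0.
      apply: ler_sum => i /sD[_ /(_ x)/andP[_ i1]].
      exact: ler_piMr.
    move=> x Kx; rewrite /g.
    (* The indices are the tests themselves, so the family is [id]. *)
    have [_ ->] := @Rintegral_sumZ _ _ _ (x.1 : probability (borel T) R) _ s w id ts.
    have [_ ->] := @Rintegral_sumZ _ _ _ (x.2 : probability (borel T) R) _ s w id ts.
    by rewrite -sumrB; apply: eq_bigr => i _; rewrite mulrBr.
  - move=> x y t [Px Qx] [Py Qy] t01.
    have [z1 Pz1 E1] := Rintegral_convex cvP Px Py t01.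
    have [z2 Qz2 E2] := Rintegral_convex cvQ Qx Qy t01.
    exists (z1, z2) => // phi /continuous_test_tests tphi.
    by rewrite /g /= E1// E2//; lra.
  - move=> phi cphi.
    (* On a product the minimum of [g phi] bounds the gap from below by [le_gap], hence the
       minimizer satisfies [g phi x <= gap P Q phi <= c]. *)
    have [x /set_mem Kx xmin] :
        exists2 x, x \in K & forall y, y \in K -> g phi x <= g phi y.
      by apply: compact_EVT_min => //; apply: continuous_subspaceT; exact: g_cont.
    exists x => //; apply: (@le_trans _ _ (gap P Q phi)).
      apply: le_gap => // mu nu Pmu Qnu.
      exact: (xmin (mu, nu) (mem_set (conj Pmu Qnu))).
    by apply: sup_upper_bound => //; exists phi.
exists mu, nu; split => // e e0.
have tvc := tv_dist_le_continuous_test h.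
have [_ [phi cphi <-] ce] := sup_adherent e0 gap_sup.
by exists phi => //; apply: le_lt_trans ce; rewrite lerD2r.
Qed.

End minimax_tests.

Theorem theorem1p8 (R : realType) (T : pmetricType R)
    (P Q : set (probability (borel T) R))
    (P0 : P !=set0) (Q0 : Q !=set0)
    (convexP : convex_set (in_ba P))
    (convexQ : convex_set (in_ba Q))
    (compactP : compact (P : set (weak_convergence T)))
    (compactQ : compact (Q : set (weak_convergence T))) :
  [/\ [/\ minimax_risk P Q =
            inf [set test_risk P Q phi
                | phi in tests (borel T) R `&` bounded_continuous T],
          inf [set test_risk P Q phi
              | phi in tests (borel T) R `&` bounded_continuous T] =
            1 - tv_dist_set (in_ba P) (in_ba Q)
        & 1 - tv_dist_set (in_ba P) (in_ba Q) =
            1 - tv_dist_set (weak_star_closed_hull (in_ba P))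
                            (weak_star_closed_hull (in_ba Q))],
      forall eps : R, 0 <= eps ->
        ((exists2 phi : T -> R, tests (borel T) R phi &
            inf [set \int[nu]_x phi x | nu in Q] >
            sup [set \int[mu]_x phi x | mu in P] + eps) <->
         tv_dist_set (tv_closed_hull (in_ba P)) (tv_closed_hull (in_ba Q)) > eps),
      forall eps : R, 0 <= eps ->
        tv_dist_set (tv_closed_hull (in_ba P)) (tv_closed_hull (in_ba Q)) > eps ->
        exists phi : T -> R,
          [/\ tests (borel T) R phi, continuous phi &
            inf [set \int[nu]_x phi x | nu in Q] >
            sup [set \int[mu]_x phi x | mu in P] + eps]
    & exists mu nu, [/\ P mu, Q nu &
        tv_dist (ba_of_probability mu) (ba_of_probability nu) =
        tv_dist_set (in_ba P) (in_ba Q)]].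
Proof.
have [mu [nu [Pmu Qnu approx]]] :=
  minimax_pair P0 Q0 convexP convexQ compactP compactQ.
set D := tv_dist (ba_of_probability mu) (ba_of_probability nu) in approx.
(* Together with [gap_D] below, this says that [D] is the supremum of the gaps of all tests. *)
have D_le x : (forall phi, tests (borel T) R phi -> gap P Q phi <= x) -> D <= x.
  move=> h; apply/ler_addgt0Pr => e /approx[phi /continuous_test_tests tphi].
  by have := h _ tphi; lra.
have gap_D phi : tests (borel T) R phi -> gap P Q phi <= D.
  move=> tphi; apply: le_trans (gap_le tphi Pmu Qnu) _; exact: test_tv_dist.
have inP : in_ba P (ba_of_probability mu) by exists mu.
have inQ : in_ba Q (ba_of_probability nu) by exists nu.
(* The gap of a test bounds from below the distance of every pair in [P * Q]. As gaps come
   arbitrarily near [D], no pair is closer than [(mu, nu)]. *)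
have dPQ : tv_dist_set (in_ba P) (in_ba Q) = D.
  apply: tv_dist_set_eq => // _ _ [p Pp <-] [q Qq <-]; apply: D_le => phi tphi.
  exact: le_trans (gap_le tphi Pp Qq) (test_tv_dist _ _ tphi).
have dtv : tv_dist_set (tv_closed_hull (in_ba P)) (tv_closed_hull (in_ba Q)) = D.
  rewrite /tv_closed_hull !convex_hull_id//.
  apply: tv_dist_set_eq; [exact: subset_closure..|] => m m' Pm Qm'.
  apply: D_le => phi tphi.
  by apply: (@gap_tv_dist_closure _ _ _ P Q (ba (borel T) R) id _ _ phi m m'
    (@tv_eval_continuous _ _ _) _ _ tphi Pm Qm').
have dws : tv_dist_set (weak_star_closed_hull (in_ba P))
    (weak_star_closed_hull (in_ba Q)) = D.
  rewrite /weak_star_closed_hull !convex_hull_id//.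
  apply: tv_dist_set_eq; [exact: subset_closure..|] => m m' Pm Qm'.
  apply: D_le => phi tphi.
  by apply: (@gap_tv_dist_closure _ _ _ P Q (weak_star (borel T) R) id _ _ phi m m'
    (@weak_star_eval_continuous _ _ _) _ _ tphi Pm Qm').
have [phi0 cphi0 _] := approx 1 ltr01.
(* The lower bound holds for every test and the approximation uses continuous ones only, so every
   class [F] in between has the same infimum. *)
have inf_risk (F : set (T -> R)) : F `<=` tests (borel T) R ->
    @continuous_test R T `<=` F ->
    inf [set test_risk P Q phi | phi in F] = 1 - D.
  move=> Ft cF.
  have lb : lbound [set test_risk P Q phi | phi in F] (1 - D).
    move=> _ [phi /Ft tphi <-]; rewrite test_risk_gap// lerD2l lerN2.
    exact: gap_D.
  apply/eqP; rewrite eq_le; apply/andP; split; last first.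
    by apply: lb_le_inf => //; exists (test_risk P Q phi0), phi0 => //; exact: cF.
  apply/ler_addgt0Pr => e /approx[phi cphi gapphi].
  have tphi := continuous_test_tests cphi.
  apply: (@le_trans _ _ (test_risk P Q phi)).
    by apply: ge_inf; [exists (1 - D)|exists phi => //; exact: cF].
  by rewrite test_risk_gap//; lra.
have risk_all : minimax_risk P Q = 1 - D.
  by apply: inf_risk => // phi; exact: continuous_test_tests.
have risk_cont : inf [set test_risk P Q phi
    | phi in tests (borel T) R `&` bounded_continuous T] = 1 - D.
  apply: inf_risk => [phi []//|phi cphi]; split.
    exact: continuous_test_tests.
  exact: continuous_test_bounded.
(* Apply [approx] with [e = D - eps]; the test obtained is continuous. *)
have separating eps : D > eps -> exists2 phi, @continuous_test R T phi &
    inf [set \int[nu]_x phi x | nu in Q] >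
    sup [set \int[mu]_x phi x | mu in P] + eps.
  rewrite -subr_gt0 => /approx[phi cphi]; rewrite opprB addrC subrK.
  by rewrite /gap ltrBrDl => h; exists phi.
rewrite dPQ dtv dws risk_all risk_cont.
split => //; last by exists mu, nu.
- move=> eps _; split=> [[phi tphi]|/separating[phi cphi h]]; last first.
    by exists phi => //; exact: continuous_test_tests.
  by rewrite -ltrBrDl => /lt_le_trans; apply; exact: gap_D.
- move=> eps _ /separating[phi cphi h]; exists phi; split => //.
    exact: continuous_test_tests.
  by case: cphi.
Qed.
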